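(* Let $G \curvearrowright (X,\mu)$ be a nonsingular ergodic action of type III$_1$ of a countable group on a standard probability space, with logarithm of the Radon-Nikodym cocycle $\omega : G \times X \to \mathbb{R}$. Let $\mathbb{R} \curvearrowright^{\alpha} (Y,\eta)$ be any ergodic flow. Then the action $$G \curvearrowright (X \times Y, \mu \times \eta) : g \cdot (x,y) = (g \cdot x, \alpha_{\omega(g,x)}(y))$$ is ergodic and has associated flow (isomorphic with) the adjoint flow $\widehat{\alpha}$.
   Context: A nonsingular action is one preserving null sets; a flow is a nonsingular action of $\mathbb{R}$ on a standard measure space. Write $(g\cdot\mu)(U)=\mu(g^{-1}\cdot U)$ and $\omega(g,x)=\log\bigl(d(g^{-1}\cdot\mu)/d\mu\bigr)(x)$, chosen such that the cocycle identity holds everywhere (same definition for flows). The Maharam extension of $G\curvearrowright(X,\mu)$ is $G\curvearrowright X\times\mathbb{R}$, $g\cdot(x,s)=(g\cdot x,\omega(g,x)+s)$, preserving the measure $d\mu(x)\times e^{-s}ds$ and commuting with $\mathbb{R}\curvearrowright X\times\mathbb{R}$, $t\cdot(x,s)=(x,t+s)$. The associated flow of $G\curvearrowright X$ is the induced flow of $\mathbb{R}$ on the space of ergodic components of $G\curvearrowright X\times\mathbb{R}$. An ergodic action is of type III$_1$ if its associated flow is the flow on one point. Adjoint flow. A flow $\mathbb{R}\curvearrowright(Z,\zeta)$ scales the $\sigma$-finite measure $\zeta$ if $t\cdot\zeta=e^t\zeta$ for all $t\in\mathbb{R}$. Given an ergodic flow $\mathbb{R}\curvearrowright^\alpha(Y,\eta)$,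 there is a unique (up to isomorphism) nonsingular ergodic action $\mathbb{R}^2\curvearrowright(Z,\zeta)$ on a standard $\sigma$-finite measure space such that both $\mathbb{R}\times\{0\}$ and $\{0\}\times\mathbb{R}$ scale $\zeta$ and such that $\mathbb{R}\curvearrowright Z/(\{0\}\times\mathbb{R})$ (the action of the first coordinate on the quotient) is isomorphic with $\alpha$. The adjoint flow $\widehat{\alpha}$ is the flow $\mathbb{R}\curvearrowright Z/(\mathbb{R}\times\{0\})$ (given by the second coordinate). Concretely, with $\beta:\mathbb{R}\times Y\to\mathbb{R}$ the logarithm of the Radon-Nikodym cocycle of $\alpha$, $\widehat{\alpha}$ is the flow given by translation in the second variable on the quotient $(Y\times\mathbb{R})/\mathbb{R}$, where $\mathbb{R}$ acts by $t\cdot(y,s)=(t\cdot y,t+\beta(t,y)+s)$. *)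

(* Defs.v *)
From HB Require Import structures.
From mathcomp Require Import all_boot all_order all_algebra.
From mathcomp Require Import all_classical all_reals all_analysis.
From mathcomp Require Import measurable_realfun.

Set Implicit Arguments.
Unset Strict Implicit.
Unset Printing Implicit Defensive.

Import Order.TTheory GRing.Theory Num.Theory.
Import numFieldNormedType.Exports.

Local Open Scope classical_set_scope.
Local Open Scope ring_scope.

Definition standard_borel (R : realType) d (T : measurableType d) : Prop :=
  exists (P : completePseudoMetricType R) (f : T -> P),
    [/\ hausdorff_space P, @second_countable P, bijective f &
      forall B : set P, <<s @open P >> B <-> measurable (f @^-1` B)].

Section ExpMeasure.
Context (R : realType).

Definition exp_measure (A : set (measurableTypeR R)) : \bar R :=
  (\int[@lebesgue_measure R]_(s in A) (expR (- s))%:E)%E.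

Let mexpN : measurable_fun [set: measurableTypeR R]
  (fun s : measurableTypeR R => (expR (- s))%:E).
Proof. by apply/measurable_EFinP; apply: measurableT_comp. Qed.

Let expN_ge0 (s : R) : (0 <= (expR (- s))%:E)%E.
Proof. by rewrite lee_fin expR_ge0. Qed.

Let exp_measure0 : exp_measure set0 = 0%E.
Proof. by rewrite /exp_measure integral_set0. Qed.

Let exp_measure_ge0 A : (0 <= exp_measure A)%E.
Proof. by apply: integral_ge0 => s _; exact: expN_ge0. Qed.

Let exp_measure_sigma_additive : semi_sigma_additive exp_measure.
Proof.
by apply: (@semi_sigma_additive_nng_induced _ _ R (@lebesgue_measure R)
  (fun s => (expR (- s))%:E)).
Qed.

HB.instance Definition _ := isMeasure.Build _ _ _ exp_measure
  exp_measure0 exp_measure_ge0 exp_measure_sigma_additive.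

Let exp_measure_sigma_finite : sigma_finite setT exp_measure.
Proof.
exists (fun n : nat => `[(- n%:R : R), n%:R]%classic).
  apply/esym; rewrite -subTset => s _; exists (Num.truncn `|s|).+1 => //=.
  by rewrite in_itv/= -ler_norml ltW// truncnS_gt.
move=> n; split; first exact: measurable_itv.
pose I : set (measurableTypeR R) := `[(- n%:R : R), n%:R]%classic.
have le_exp : (exp_measure I <=
    \int[@lebesgue_measure R]_(s in I) (expR n%:R)%:E)%E.
  apply: ge0_le_integral => //.
  - exact: measurable_itv.
  - exact: measurable_funTS.
  - by move=> s; rewrite /I /= in_itv/= lee_fin ler_expR lerNl => /andP[].
apply: (le_lt_trans le_exp).
rewrite integral_cst/=; last exact: measurable_itv.
rewrite lebesgue_measure_itv/=.
by case: ifP => _; rewrite ?mule0 ?ltry// -EFinD -EFinM ltry.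
Qed.

HB.instance Definition _ :=
  Measure_isSigmaFinite.Build _ _ _ exp_measure exp_measure_sigma_finite.

End ExpMeasure.

(** The translate [(g . m)(U) = m(g^-1 . U)] of a measure is
    [pushforward m (a g)]. *)
Section Actions.
Context (R : realType) d (T : measurableType d).

Section Families.
Context (I : Type) (m : {measure set T -> \bar R}) (a : I -> T -> T).

Definition preserves_null_sets : Prop :=
  forall i (A : set T), measurable A -> m (a i @^-1` A) = 0%E <-> m A = 0%E.

(** Invariance is up to null sets, for each element of the group separately.
    For Borel actions of locally compact second countable groups, any such set
    agrees up to a null set with a strictly invariant one. *)
Definition invariant_set (A : set T) : Prop :=
  measurable A /\ forall i, {ae m, forall x, A (a i x) <-> A x}.

Definition ergodic : Prop :=
  forall A, invariant_set A ->
    {ae m, forall x, A x} \/ {ae m, forall x, ~ A x}.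

End Families.

Definition nonsingular_action (G : groupType) (m : {measure set T -> \bar R})
    (a : G -> T -> T) : Prop :=
  [/\ forall x, a 1%g x = x,
      forall g h x, a (g * h)%g x = a g (a h x),
      forall g, measurable_fun [set: T] (a g) &
      preserves_null_sets m a].

(** [omega g] is the logarithm of [d(g^-1 . m) / dm], and the cocycle identity
    holds everywhere. *)
Definition log_RN_cocycle (G : groupType) (m : {measure set T -> \bar R})
    (a : G -> T -> T) (omega : G -> T -> R) : Prop :=
  [/\ forall g, measurable_fun [set: T] (omega g),
      forall g h x, omega (g * h)%g x = omega g (a h x) + omega h x &
      forall g (A : set T), measurable A ->
        pushforward m (a g^-1%g) A =
        (\int[m]_(x in A) (expR (omega g x))%:E)%E].

Definition nonsingular_flow (m : {measure set T -> \bar R})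
    (alpha : R -> T -> T) : Prop :=
  [/\ standard_borel R T,
      forall x, alpha 0 x = x,
      forall s t x, alpha (s + t) x = alpha s (alpha t x),
      measurable_fun [set: R * T] (fun p : R * T => alpha p.1 p.2) &
      preserves_null_sets m alpha].

Definition flow_log_RN_cocycle (m : {measure set T -> \bar R})
    (alpha : R -> T -> T) (beta : R -> T -> R) : Prop :=
  [/\ measurable_fun [set: R * T] (fun p : R * T => beta p.1 p.2),
      forall s t x, beta (s + t) x = beta s (alpha t x) + beta t x &
      forall t (A : set T), measurable A ->
        pushforward m (alpha (- t)) A =
        (\int[m]_(x in A) (expR (beta t x))%:E)%E].

Definition nonsingular_plane_action (m : {measure set T -> \bar R})
    (gamma : R * R -> T -> T) : Prop :=
  [/\ standard_borel R T,
      forall x, gamma 0 x = x,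
      forall u v x, gamma (u + v) x = gamma u (gamma v x),
      measurable_fun [set: (R * R) * T]
        (fun p : (R * R) * T => gamma p.1 p.2) &
      preserves_null_sets m gamma].

Definition scales (m : {measure set T -> \bar R}) (alpha : R -> T -> T) : Prop :=
  forall t (A : set T), measurable A ->
    pushforward m (alpha t) A = ((expR t)%:E * m A)%E.

End Actions.

(** [(Z, zeta)], with the map [p], is the space of ergodic components of the
    action [a] on [(T, m)]: up to null sets, [p] identifies the measurable
    subsets of [Z] with the [a]-invariant subsets of [T].  For standard [Z]
    this determines [(Z, [zeta])] up to isomorphism. *)
Definition ergodic_components (R : realType) d (T : measurableType d)
    (m : {measure set T -> \bar R}) (I : Type) (a : I -> T -> T)
    d' (Z : measurableType d') (zeta : {measure set Z -> \bar R})
    (p : T -> Z) : Prop :=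
  [/\ measurable_fun [set: T] p,
      forall i, {ae m, forall x, p (a i x) = p x},
      forall B : set Z, measurable B ->
        zeta B = 0%E <-> m (p @^-1` B) = 0%E &
      forall A : set T, invariant_set m a A ->
        exists2 B : set Z, measurable B & {ae m, forall x, A x <-> B (p x)}].

(** [phi] is (isomorphic with) the flow that [theta], which commutes with [a],
    induces on the space of ergodic components of [a].  This is also the
    reading of the quotient of a measure space by an action of [R]. *)
Definition quotient_flow (R : realType) d (T : measurableType d)
    (m : {measure set T -> \bar R}) (I : Type) (a : I -> T -> T)
    (theta : R -> T -> T) d' (Z : measurableType d')
    (zeta : {measure set Z -> \bar R}) (phi : R -> Z -> Z) : Prop :=
  nonsingular_flow zeta phi /\
  exists p : T -> Z, ergodic_components m a zeta p /\
    forall t, {ae m, forall x, p (theta t x) = phi t (p x)}.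

Section AssociatedFlow.
Context (R : realType) (G : groupType) d (T : measurableType d).

Definition maharam (a : G -> T -> T) (omega : G -> T -> R) (g : G)
    (p : T * measurableTypeR R) : T * measurableTypeR R :=
  (a g p.1, omega g p.1 + p.2).

Definition vertical_translation (t : R) (p : T * measurableTypeR R) :
    T * measurableTypeR R :=
  (p.1, t + p.2).

(** Only determined up to isomorphism, hence a relation. *)
Definition associated_flow (m : {measure set T -> \bar R})
    (a : G -> T -> T) (omega : G -> T -> R)
    d' (Z : measurableType d') (zeta : {measure set Z -> \bar R})
    (phi : R -> Z -> Z) : Prop :=
  quotient_flow (m \x @exp_measure R)%E (maharam a omega)
    vertical_translation zeta phi.

Definition type_III1 (m : {measure set T -> \bar R})
    (a : G -> T -> T) (omega : G -> T -> R) : Prop :=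
  associated_flow m a omega (@dirac _ unit tt R) (fun _ : R => @id unit).

End AssociatedFlow.

(** [phi] on [(Z, zeta)] is (isomorphic with) the adjoint flow of [alpha]: for
    an ergodic action of [R^2] both coordinates of which scale the measure, the
    quotient by the second coordinate is [alpha] and the quotient by the first
    coordinate is [phi]. *)
Definition adjoint_flow (R : realType)
    d (Y : measurableType d) (eta : {measure set Y -> \bar R})
    (alpha : R -> Y -> Y)
    d' (Z : measurableType d') (zeta : {measure set Z -> \bar R})
    (phi : R -> Z -> Z) : Prop :=
  exists dW (W : measurableType dW)
    (xi : {sigma_finite_measure set W -> \bar R}) (gamma : R * R -> W -> W),
    let first (t : R) := gamma (t, 0) in
    let second (t : R) := gamma (0, t) in
    [/\ nonsingular_plane_action xi gamma /\ ergodic xi gamma,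
        scales xi first,
        scales xi second,
        quotient_flow xi second first eta alpha &
        quotient_flow xi first second zeta phi].

Definition skew_action (R : realType) (G : groupType) (X Y : Type)
    (a : G -> X -> X) (omega : G -> X -> R) (alpha : R -> Y -> Y)
    (g : G) (p : X * Y) : X * Y :=
  (a g p.1, alpha (omega g p.1) p.2).

(* Main.v *)
Require Import Defs.
From HB Require Import structures.
From mathcomp Require Import all_boot all_order all_algebra.
From mathcomp Require Import all_classical all_reals all_analysis.
From mathcomp Require Import measurable_realfun.
From mathcomp Require Import lra.

Set Implicit Arguments.
Unset Strict Implicit.
Unset Printing Implicit Defensive.

Import Order.TTheory GRing.Theory Num.Theory.
Import numFieldNormedType.Exports.

Local Open Scope classical_set_scope.
Local Open Scope ring_scope.

(** Let W = Y x R with the measure xi = eta x exp (- s) ds, and let the plane act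
    on it by (t, u).(y, s) = (t.y, t + u + beta(t, y) + s).  Both coordinates
    scale xi and the quotient by the second one is the flow alpha, so the
    quotient by the first one is the adjoint flow ([flow_plane_nonsingular],
    [flow_plane_scales], [flow_plane_ergodic], [flow_plane_vertical_quotient]).

    The logarithm of the Radon-Nikodym cocycle of the skew action on X x Y is
    omega(g, x) + beta(omega(g, x), y) ([skew_action_log_RN]).  Its Maharam
    extension is therefore, on X x W, again a skew action
    g.(x, w) = (g.x, gamma_(omega(g, x)) w), where gamma is the first coordinate
    of the plane ([maharam_skew_action]).

    Ergodicity and the computation of the associated flow thus both follow from
    one fact about an arbitrary nonsingular flow gamma on a space W: up to null
    sets, the sets invariant under the skew action on X x W are the X x D with D
    invariant under gamma ([skew_invariant_set]).  Indeed type III_1 means that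
    the Maharam extension of X is ergodic, and the map
    ((x, r), w) |-> (x, gamma_r w) intertwines its product with the identity of W
    with the skew action.  An invariant set pulls back to a set whose fibres over
    W are invariant, hence null or conull; so the pull-back is a cylinder over a
    set D0, and comparing the fibres over different r shows that D0 is, up to
    null sets, invariant under gamma.  Taking Y for W gives ergodicity.  Taking
    Y x R for W, a map that identifies the ergodic components of the Maharam
    extension depends only on w and identifies those of gamma
    ([skew_ergodic_components]). *)

(** * Null sets of product measures *)

Lemma measurable_preimage d1 d2 (T1 : measurableType d1)
    (T2 : measurableType d2) (f : T1 -> T2) (A : set T2) :
  measurable_fun [set: T1] f -> measurable A -> measurable (f @^-1` A).
Proof. by move=> mf mA; rewrite -[X in measurable X]setTI; exact: mf. Qed.

Lemma measurable_iff d (T : measurableType d) (A B : set T) :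
  measurable A -> measurable B -> measurable [set x | A x <-> B x].
Proof.
move=> mA mB.
have -> : [set x | A x <-> B x] = (A `&` B) `|` (~` A `&` ~` B).
  apply/seteqP; split => x /=; last by move=> [[]|[]] ? ?; split.
  by have [Ax|nAx] := pselect (A x) => AB; [left|right]; tauto.
by apply: measurableU; apply: measurableI => //; exact: measurableC.
Qed.

Section SigmaFiniteProduct.
Context (R : realType) d1 d2 (T1 : measurableType d1) (T2 : measurableType d2).
Variables (m1 : {sigma_finite_measure set T1 -> \bar R})
  (m2 : {sigma_finite_measure set T2 -> \bar R}).

Let sigma_finite_product_subproof : sigma_finite setT (m1 \x m2)%E.
Proof.
have /sigma_finiteP[F [UF ndF Foo]] := sigma_finiteT m1.
have /sigma_finiteP[K [UK ndK Koo]] := sigma_finiteT m2.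
exists (fun n => F n `*` K n).
  apply/esym; rewrite -subTset => -[x y] _.
  have [n _ Fnx] : (\bigcup_n F n) x by rewrite -UF.
  have [k _ Kky] : (\bigcup_n K n) y by rewrite -UK.
  exists (maxn n k) => //; split => /=.
  - by move: Fnx; apply/subsetPset/ndF/leq_maxl.
  - by move: Kky; apply/subsetPset/ndK/leq_maxr.
move=> n; have [mF Fny] := Foo n; have [mK Kny] := Koo n.
split; first exact: measurableX.
by rewrite product_measure1E// lte_mul_pinfty// ge0_fin_numE.
Qed.

(** Bundling sigma-finiteness lets a product be a factor of a further product. *)
Definition sigma_finite_product :
    {sigma_finite_measure set (T1 * T2)%type -> \bar R} :=
  HB.pack (m1 \x m2)%E
    (Measure_isSigmaFinite.Build _ _ _ (m1 \x m2)%E sigma_finite_product_subproof).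

End SigmaFiniteProduct.
Local Notation "m1 '\xs' m2" := (sigma_finite_product m1 m2)
  (at level 40, left associativity).

Section AlmostEverywhere.
Context (R : realType).

Lemma ae_forall_countable d (T : measurableType d)
    (m : {measure set T -> \bar R}) (I : Type) (P : I -> T -> Prop) :
  countable [set: I] -> (forall i, {ae m, forall x, P i x}) ->
  {ae m, forall x, forall i, P i x}.
Proof.
move=> /countable_injP[f /in2TT finj] aeP.
have : {ae m, forall x, forall n i, f i = n -> P i x}.
  apply: ae_foralln => n.
  have [[i fi]|nfi] := pselect (exists i, f i = n).
    by apply: filterS (aeP i) => x Px j fj; rewrite (finj j i)// fi fj.
  by apply: aeW => x i fi; exfalso; apply: nfi; exists i.
by apply: filterS => x Px i; exact: (Px (f i)).
Qed.

Lemma ae_exists d (T : measurableType d) (m : {measure set T -> \bar R})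
    (P : T -> Prop) :
  (m setT != 0)%E -> {ae m, forall x, P x} -> exists x, P x.
Proof.
move=> mT0 [N [mN N0 PN]]; apply: contrapT => nP; case/eqP: mT0.
rewrite -N0; congr (m _); apply/esym/seteqP; split => // x _; apply: PN => /= Px.
by apply: nP; exists x.
Qed.

Lemma ae_measurable0 d (T : measurableType d) (m : {measure set T -> \bar R})
    (A : set T) : measurable A ->
  m A = 0%E <-> {ae m, forall x, ~ A x}.
Proof.
move=> mA; rewrite -(negligibleP _ mA).
have {1}-> : A = ~` [set x | ~ A x].
  by apply/seteqP; split => x /=; rewrite not_notE.
exact: iff_refl.
Qed.

Lemma ae_pullback d1 d2 (T1 : measurableType d1) (T2 : measurableType d2)
    (m1 : {measure set T1 -> \bar R}) (m2 : {measure set T2 -> \bar R})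
    (f : T1 -> T2) :
  measurable_fun [set: T1] f ->
  (forall A, measurable A -> m2 A = 0%E -> m1 (f @^-1` A) = 0%E) ->
  forall P : T2 -> Prop,
    {ae m2, forall y, P y} -> {ae m1, forall x, P (f x)}.
Proof.
move=> mf f0 P [N [mN N0 PN]]; exists (f @^-1` N); split.
- exact: measurable_preimage.
- exact: f0.
- by move=> x /= /PN.
Qed.

Section Product.
Context d1 d2 (T1 : measurableType d1) (T2 : measurableType d2).
Variables (m1 : {sigma_finite_measure set T1 -> \bar R})
  (m2 : {sigma_finite_measure set T2 -> \bar R}).

Lemma product_null_sections (A : set (T1 * T2)) : measurable A ->
  (m1 \x m2)%E A = 0%E <-> {ae m1, forall x, m2 (xsection A x) = 0%E}.
Proof.
move=> mA.
have mf : measurable_fun setT (m2 \o xsection A) by exact: measurable_fun_xsection.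
have absE : (\int[m1]_x `|(m2 \o xsection A) x|)%E = (m1 \x m2)%E A.
  by apply: eq_integral => x _; rewrite gee0_abs.
rewrite -absE (ae_eq_integral_abs m1 measurableT mf).
by split; apply: filterS => x /= h; [exact: h | move=> _; exact: h].
Qed.

(** The exceptions to [P] are covered by a measurable null set, whose sections
    are almost all null. *)
Lemma ae_sections (P : T1 * T2 -> Prop) :
  {ae (m1 \x m2)%E, forall z, P z} ->
  {ae m1, forall x, {ae m2, forall y, P (x, y)}}.
Proof.
move=> [N [mN N0 PN]].
have := (product_null_sections mN).1 N0; apply: filterS => x Nx0.
exists (xsection N x); split => //; first exact: measurable_xsection.
by move=> y /= nP; apply/xsectionP; exact: PN.
Qed.

Lemma sections_ae (P : T1 * T2 -> Prop) : measurable [set z | P z] ->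
  {ae m1, forall x, {ae m2, forall y, P (x, y)}} ->
  {ae (m1 \x m2)%E, forall z, P z}.
Proof.
move=> mP aeP; have mCP := measurableC mP; apply/negligibleP => //.
apply/product_null_sections => //; apply: filterS aeP => x aePx.
apply/ae_measurable0; first exact: measurable_xsection.
by apply: filterS aePx => y Py /xsectionP/=; apply.
Qed.

End Product.

Lemma ae_swap d1 d2 (T1 : measurableType d1) (T2 : measurableType d2)
    (m1 : {sigma_finite_measure set T1 -> \bar R})
    (m2 : {sigma_finite_measure set T2 -> \bar R}) (P : T1 * T2 -> Prop) :
  {ae (m1 \x m2)%E, forall z, P z} ->
  {ae (m2 \x m1)%E, forall z, P (z.2, z.1)}.
Proof.
apply: (@ae_pullback _ _ _ _ (m2 \x m1)%E (m1 \x m2)%E (fun z => (z.2, z.1))).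
  exact: measurable_swap.
move=> A mA A0.
transitivity ((m1 \x^ m2)%E A); last first.
  rewrite -A0; apply/esym/product_measure_unique => // B D mB mD.
  exact: product_measure2E.
apply: eq_integral => y _ /=.
by congr (m1 _); apply/seteqP; split => x /=; rewrite /xsection /ysection/= !inE.
Qed.

Lemma ae_sections_swap d1 d2 (T1 : measurableType d1) (T2 : measurableType d2)
    (m1 : {sigma_finite_measure set T1 -> \bar R})
    (m2 : {sigma_finite_measure set T2 -> \bar R}) (P : T1 * T2 -> Prop) :
  {ae (m1 \x m2)%E, forall z, P z} ->
  {ae m2, forall y, {ae m1, forall x, P (x, y)}}.
Proof. by move=> /ae_swap/ae_sections. Qed.

Lemma sections_ae_swap d1 d2 (T1 : measurableType d1) (T2 : measurableType d2)
    (m1 : {sigma_finite_measure set T1 -> \bar R})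
    (m2 : {sigma_finite_measure set T2 -> \bar R}) (P : T1 * T2 -> Prop) :
  measurable [set z | P z] ->
  {ae m2, forall y, {ae m1, forall x, P (x, y)}} ->
  {ae (m1 \x m2)%E, forall z, P z}.
Proof.
move=> mP aeP.
have : {ae (m2 \x m1)%E, forall z, P (z.2, z.1)}.
  apply: sections_ae => //; apply: (measurable_preimage _ mP).
  exact: measurable_swap.
by move=> /ae_swap; apply: filterS => -[].
Qed.

Lemma ae_snd d1 d2 (T1 : measurableType d1) (T2 : measurableType d2)
    (m1 : {sigma_finite_measure set T1 -> \bar R})
    (m2 : {sigma_finite_measure set T2 -> \bar R}) (P : T2 -> Prop) :
  {ae m2, forall y, P y} -> {ae (m1 \x m2)%E, forall z, P z.2}.
Proof.
move=> [N [mN N0 PN]].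
have : {ae (m1 \x m2)%E, forall z, ~ N z.2}.
  apply: sections_ae; last first.
    by apply: aeW => x; exact: ((ae_measurable0 m2 mN).1 N0).
  exact: (measurable_preimage measurable_snd (measurableC mN)).
by apply: filterS => z nNz; apply: contrapT => /PN.
Qed.

Lemma ae_fst d1 d2 (T1 : measurableType d1) (T2 : measurableType d2)
    (m1 : {sigma_finite_measure set T1 -> \bar R})
    (m2 : {sigma_finite_measure set T2 -> \bar R}) (P : T1 -> Prop) :
  {ae m1, forall x, P x} -> {ae (m1 \x m2)%E, forall z, P z.1}.
Proof. by move=> /(ae_snd m2)/ae_swap. Qed.

Lemma ae_fst_inv d1 d2 (T1 : measurableType d1) (T2 : measurableType d2)
    (m1 : {sigma_finite_measure set T1 -> \bar R})
    (m2 : {sigma_finite_measure set T2 -> \bar R}) (P : T1 -> Prop) :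
  m2 setT != 0%E -> {ae (m1 \x m2)%E, forall z, P z.1} -> {ae m1, forall x, P x}.
Proof.
move=> m20 /ae_sections; apply: filterS => x.
by move=> /(ae_exists m20)[].
Qed.

Lemma ae_snd_inv d1 d2 (T1 : measurableType d1) (T2 : measurableType d2)
    (m1 : {sigma_finite_measure set T1 -> \bar R})
    (m2 : {sigma_finite_measure set T2 -> \bar R}) (P : T2 -> Prop) :
  m1 setT != 0%E -> {ae (m1 \x m2)%E, forall z, P z.2} -> {ae m2, forall y, P y}.
Proof. by move=> m10 /ae_swap/(ae_fst_inv m10). Qed.

(** The spaces (X x Y) x R and X x (Y x R) both occur below; reading null sets
    section by section shows that reassociation preserves them. *)
Section Reassociation.
Context d1 d2 d3 (T1 : measurableType d1) (T2 : measurableType d2)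
  (T3 : measurableType d3).
Variables (m1 : {sigma_finite_measure set T1 -> \bar R})
  (m2 : {sigma_finite_measure set T2 -> \bar R})
  (m3 : {sigma_finite_measure set T3 -> \bar R}).

Let assocl (z : T1 * (T2 * T3)) : (T1 * T2) * T3 := ((z.1, z.2.1), z.2.2).
Let assocr (z : (T1 * T2) * T3) : T1 * (T2 * T3) := (z.1.1, (z.1.2, z.2)).

Let measurable_assocl : measurable_fun setT assocl.
Proof.
apply: measurable_fun_pair; last exact: measurableT_comp.
by apply: measurable_fun_pair => //; exact: measurableT_comp.
Qed.

Let measurable_assocr : measurable_fun setT assocr.
Proof.
apply: measurable_fun_pair; first exact: measurableT_comp.
by apply: measurable_fun_pair => //; exact: measurableT_comp.
Qed.

Lemma ae_assocl (P : (T1 * T2) * T3 -> Prop) :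
  {ae ((m1 \xs m2) \xs m3), forall z, P z} ->
  {ae (m1 \xs (m2 \xs m3)), forall z, P ((z.1, z.2.1), z.2.2)}.
Proof.
apply: (@ae_pullback _ _ (T1 * (T2 * T3))%type
  ((T1 * T2) * T3)%type (m1 \xs (m2 \xs m3))
  ((m1 \xs m2) \xs m3) _ measurable_assocl) => A mA A0.
have mA' := measurable_preimage measurable_assocl mA.
apply/ae_measurable0 => //; have mC := measurableC mA'.
move/ae_measurable0 : A0 => /(_ mA) /ae_sections/ae_sections A0.
apply: sections_ae => //; apply: filterS A0 => x A0.
by apply: sections_ae => //; exact: (measurable_preimage (pair1_measurable x) mC).
Qed.

Lemma ae_assocr (P : T1 * (T2 * T3) -> Prop) :
  {ae (m1 \xs (m2 \xs m3)), forall z, P z} ->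
  {ae ((m1 \xs m2) \xs m3), forall z, P (z.1.1, (z.1.2, z.2))}.
Proof.
apply: (@ae_pullback _ _ ((T1 * T2) * T3)%type
  (T1 * (T2 * T3))%type ((m1 \xs m2) \xs m3)
  (m1 \xs (m2 \xs m3)) _ measurable_assocr) => A mA A0.
have mA' := measurable_preimage measurable_assocr mA.
apply/product_null_sections => //.
have mf : measurable_fun setT (m3 \o xsection (assocr @^-1` A)).
  exact: measurable_fun_xsection.
apply: sections_ae; first exact: (measurable_preimage mf (emeasurable_set1 0)).
move/ae_measurable0 : A0 => /(_ mA) /ae_sections; apply: filterS => x.
move=> /ae_sections; apply: filterS => y nA.
apply/ae_measurable0; first exact: measurable_xsection.
by apply: filterS nA => z nA /xsectionP.
Qed.

End Reassociation.

(** A skew product of null-preserving maps preserves null sets: the section of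
    the preimage at [x] is the preimage under [f x] of the section at [g x]. *)
Lemma skew_product_null d1 d2 d1' d2'
    (T1 : measurableType d1) (T2 : measurableType d2)
    (T1' : measurableType d1') (T2' : measurableType d2')
    (m1 : {sigma_finite_measure set T1 -> \bar R})
    (m2 : {sigma_finite_measure set T2 -> \bar R})
    (m1' : {sigma_finite_measure set T1' -> \bar R})
    (m2' : {sigma_finite_measure set T2' -> \bar R})
    (g : T1 -> T1') (f : T1 -> T2 -> T2') :
  measurable_fun setT g ->
  measurable_fun setT (fun z : T1 * T2 => f z.1 z.2) ->
  (forall A, measurable A -> m1' A = 0%E -> m1 (g @^-1` A) = 0%E) ->
  (forall x A, measurable A -> m2' A = 0%E -> m2 (f x @^-1` A) = 0%E) ->
  forall A, measurable A -> (m1' \x m2')%E A = 0%E ->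
    (m1 \x m2)%E ((fun z => (g z.1, f z.1 z.2)) @^-1` A) = 0%E.
Proof.
move=> mg mf g0 f0 A mA /(product_null_sections _ _ mA) A0.
apply/product_null_sections.
  apply: measurable_preimage => //.
  by apply: measurable_fun_pair => //; exact: measurableT_comp.
apply: filterS (ae_pullback mg g0 A0) => x A0x.
rewrite -[RHS](f0 x _ (measurable_xsection (g x) mA) A0x).
by congr (m2 _).
Qed.

End AlmostEverywhere.

(** * Cylinders and separating families *)

(** A set whose fibres over [W] are all null or conull is a cylinder.  Its base
    consists of the points with conull fibre; it is measurable because the
    measure of the fibre is a measurable function. *)
Lemma fiberwise_trivial_set (R : realType) d1 d2 (T : measurableType d1)
    (W : measurableType d2) (m : {sigma_finite_measure set T -> \bar R})
    (n : {sigma_finite_measure set W -> \bar R}) (A : set (T * W)) :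
  measurable A ->
  {ae n, forall w, {ae m, forall x, A (x, w)} \/ {ae m, forall x, ~ A (x, w)}} ->
  exists2 D, measurable D & {ae (m \x n)%E, forall z, A z <-> D z.2}.
Proof.
move=> mA trivA; have mCA := measurableC mA.
pose D := (m \o ysection (~` A)) @^-1` [set 0%E].
have mD : measurable D.
  apply: (measurable_preimage _ (emeasurable_set1 0)).
  exact: measurable_fun_ysection.
have DE w : D w <-> {ae m, forall x, A (x, w)}.
  rewrite /D /= (ae_measurable0 m (measurable_ysection w mCA)).
  split; apply: filterS => x; last by move=> Ax /ysectionP /=; apply.
  by move=> nA; apply: contrapT => nAx; apply: nA; apply/ysectionP.
exists D => //; apply: sections_ae_swap.
  by apply: measurable_iff => //; exact: (measurable_preimage measurable_snd mD).
apply: filterS trivA => w [aeA|aeNA].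
  by have Dw := (DE w).2 aeA; apply: filterS aeA => x Ax.
have [Dw|nDw] := pselect (D w); last by apply: filterS aeNA => x nAx; split.
by apply: filterS2 aeNA ((DE w).1 Dw) => x nAx Ax; split.
Qed.

(** An ergodic action on [T], extended by the identity to [T * W], has only
    cylinders as invariant sets.  Countability is used to find one null set of
    fibres outside of which the fibre is invariant under the whole family. *)
Lemma invariant_product_set (R : realType) d1 d2 (T : measurableType d1)
    (W : measurableType d2) (m : {sigma_finite_measure set T -> \bar R})
    (n : {sigma_finite_measure set W -> \bar R}) (I : Type) (b : I -> T -> T)
    (A : set (T * W)) :
  countable [set: I] -> ergodic m b -> measurable A ->
  (forall i, {ae (m \x n)%E, forall z, A (b i z.1, z.2) <-> A z}) ->
  exists2 D, measurable D & {ae (m \x n)%E, forall z, A z <-> D z.2}.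
Proof.
move=> cI erg mA invA; apply: fiberwise_trivial_set => //.
have : {ae n, forall w, forall i,
    {ae m, forall x, A (b i x, w) <-> A (x, w)}}.
  by apply: ae_forall_countable => // i; exact: ae_sections_swap (invA i).
apply: filterS => w invw; apply: (erg [set x | A (x, w)]); split => //.
exact: (measurable_preimage (pair2_measurable w) mA).
Qed.

(** A countable basis of a Hausdorff space separates its points, so that almost
    everywhere equality of maps into a standard Borel space can be tested on
    countably many sets. *)
Lemma standard_borel_separated (R : realType) d (Z : measurableType d) :
  standard_borel R Z ->
  exists B : nat -> set Z, (forall n, measurable (B n)) /\
    forall z z', (forall n, B n z <-> B n z') -> z = z'.
Proof.
move=> [P [f [hP [U cU [oU bU]] bijf BE]]].
have /pfcard_geP[U0|[g]] : (U #<= [set: nat])%card := cU.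
  by have [V [UV _] _] := bU point setT filterT; rewrite U0 in UV.
exists (fun n => f @^-1` g n); split.
  move=> n; apply/BE; apply: sub_sigma_algebra; apply: oU.
  exact: funS.
move=> z z' Bzz'; apply: (bij_inj bijf); apply: hP => A B Az Bz'.
have [V [UV Vz] VA] := bU _ _ Az.
have [n _ gn] := surj (f:=g) UV.
exists (f z'); split; last exact: nbhs_singleton.
by apply: VA; rewrite -gn; apply/(Bzz' n); rewrite /= gn.
Qed.

(** * Translations and the measure with density exp (- s) *)

Section ExpMeasureTranslation.
Context (R : realType).
Implicit Types (c : R) (A : set (measurableTypeR R)).

Let mtranslate c : measurable_fun [set: measurableTypeR R]
  (fun s : measurableTypeR R => c + s : measurableTypeR R).
Proof. by apply: measurable_funD; [exact: measurable_cst|exact: measurable_id]. Qed.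

Lemma lebesgue_measure_translation c A : measurable A ->
  pushforward (@lebesgue_measure R)
    (fun s : measurableTypeR R => c + s : measurableTypeR R) A =
  lebesgue_measure A.
Proof.
move=> mA; apply/esym.
apply: (@lebesgue_measure_unique R (pushforward (@lebesgue_measure R)
    (fun s : measurableTypeR R => c + s : measurableTypeR R))) => //= _ [[a b]] _ <-.
rewrite /pushforward.
have -> : (fun s : R => c + s) @^-1` `]a, b] = `]a - c, b - c]%classic.
  by apply/seteqP; split => s /=; rewrite !in_itv/= ltrBlDl lerBrDl.
rewrite !lebesgue_measure_itv/= !lte_fin ltrD2r; case: ifPn => // _.
by rewrite -!EFinB opprB addrA subrK.
Qed.

Lemma exp_measure_translation c A : measurable A ->
  @exp_measure R ((fun s => c + s) @^-1` A) = ((expR c)%:E * @exp_measure R A)%E.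
Proof.
move=> mA; rewrite /exp_measure.
have mf : measurable_fun [set: measurableTypeR R]
    (fun s : measurableTypeR R => (expR (- s))%:E).
  by apply/measurable_EFinP; apply: measurableT_comp.
have mg : measurable_fun A (fun s : measurableTypeR R => (expR (c - s))%:E).
  apply: measurable_funTS; apply/measurable_EFinP; apply: measurableT_comp => //.
  exact: measurable_funB.
rewrite -ge0_integralZl//; last exact: measurable_funTS.
transitivity (\int[pushforward (@lebesgue_measure R)
    (fun s : measurableTypeR R => c + s : measurableTypeR R)%R]_(s in A)
    (expR (c - s))%:E)%E.
  rewrite ge0_integral_pushforward//.
  by apply: eq_integral => s _ /=; rewrite opprD addrA subrr add0r.
transitivity (\int[@lebesgue_measure R]_(s in A) (expR (c - s))%:E)%E.
  by apply: eq_measure_integral => B mB _; exact: lebesgue_measure_translation.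
by apply: eq_integral => s _; rewrite expRD EFinM.
Qed.

Lemma exp_measure_setT_neq0 : (@exp_measure R setT != 0)%E.
Proof.
apply/eqP => exp0.
have mf : measurable_fun [set: measurableTypeR R]
    (fun s : measurableTypeR R => (expR (- s))%:E).
  by apply/measurable_EFinP; apply: measurableT_comp.
have /(ae_eq_integral_abs (@lebesgue_measure R) measurableT mf) ae0 :
    (\int[@lebesgue_measure R]_(s in setT) `|(expR (- s))%:E| = 0)%E.
  by rewrite -exp0; apply: eq_integral => s _; rewrite gee0_abs// lee_fin expR_ge0.
have [|s /(_ I) [/eqP]] := ae_exists _ ae0; last by rewrite gt_eqF ?expR_gt0.
apply/eqP => leb0.
have : (@lebesgue_measure R `[0%R, 1%R] <= @lebesgue_measure R setT)%E.
  by apply: le_measure; rewrite ?inE//; exact: measurable_itv.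
by rewrite leb0 lebesgue_measure_itv/= lte_fin ltr01 sube0 lee_fin ler10.
Qed.

Lemma exp_measure_ae_translation t (P : measurableTypeR R -> Prop) :
  {ae @exp_measure R, forall r : measurableTypeR R, P r} ->
  {ae @exp_measure R, forall r : measurableTypeR R, P (t + r)}.
Proof.
apply: (@ae_pullback _ _ _ _ _ _ _
  (fun r : measurableTypeR R => t + r : measurableTypeR R)).
  by apply: measurable_funD.
move=> A mA A0; have := exp_measure_translation t mA.
by rewrite [X in (_ * X)%E]A0 mule0.
Qed.

End ExpMeasureTranslation.

(** * Skew actions over an action with ergodic Maharam extension *)

Section SkewInvariant.
Context (R : realType) (G : groupType) (hG : countable [set: G]).
Context (dX : measure_display) (X : measurableType dX) (mu : probability X R)
  (a : G -> X -> X) (omega : G -> X -> R).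
Hypothesis maharam_ergodic : ergodic (mu \x @exp_measure R)%E (maharam a omega).
Context (dW : measure_display) (W : measurableType dW)
  (xi : {sigma_finite_measure set W -> \bar R}) (gamma : R -> W -> W).
Hypothesis gamma0 : forall w, gamma 0 w = w.
Hypothesis gammaD : forall s t w, gamma (s + t) w = gamma s (gamma t w).
Hypothesis mgamma : measurable_fun [set: R * W]
  (fun p : R * W => gamma p.1 p.2).
Hypothesis gamma_null : preserves_null_sets xi gamma.

Let mgamma2 d (T : measurableType d) (f : T -> R) (h : T -> W) :
  measurable_fun setT f -> measurable_fun setT h ->
  measurable_fun setT (fun z => gamma (f z) (h z)).
Proof.
by move=> mf mh; exact: (measurableT_comp mgamma (measurable_fun_pair mf mh)).
Qed.

Let mgamma1 t : measurable_fun [set: W] (gamma t).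
Proof. exact: (measurable_fun_pair2 t mgamma). Qed.

Lemma ae_flow t (P : W -> Prop) :
  {ae xi, forall w, P w} -> {ae xi, forall w, P (gamma t w)}.
Proof. by apply: ae_pullback => // A mA; apply (gamma_null t mA). Qed.

(** Intertwines (Maharam extension) x (identity of [W]) with the skew action:
    replacing [r] by [omega g x + r] applies [gamma (omega g x)] to the second
    component. *)
Let unroll (z : (X * measurableTypeR R) * W) : X * W :=
  (z.1.1, gamma z.1.2 z.2).

Let measurable_unroll : measurable_fun setT unroll.
Proof.
apply: measurable_fun_pair; first exact: measurableT_comp.
by apply: mgamma2 => //; exact: measurableT_comp.
Qed.

Let ae_unroll (P : X * W -> Prop) : {ae (mu \x xi)%E, forall z, P z} ->
  {ae ((mu \xs @exp_measure R) \x xi)%E, forall z, P (unroll z)}.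
Proof.
apply: (@ae_pullback _ _ _ _ _ ((mu \xs @exp_measure R) \xs xi) (mu \xs xi)
  _ measurable_unroll).
apply: (@skew_product_null _ _ _ _ _ _ _ _ _ (mu \xs @exp_measure R) xi mu xi
   fst (fun xr w => gamma xr.2 w)) => //.
- by apply: mgamma2 => //; exact: measurableT_comp.
- move=> A mA A0.
  have -> : fst @^-1` A = A `*` [set: measurableTypeR R].
    by apply/seteqP; split=> -[x r] //= [].
  by rewrite /= product_measure1E// [X in (X * _)%E]A0 mul0e.
- by move=> xr A mA; apply (gamma_null xr.2 mA).
Qed.

(** Pulled back by [unroll], the set [A] becomes invariant under an ergodic
    action on [X * R] that fixes [W], hence a cylinder over some [D0].  Fixing
    one generic [r] shows that [A] is a cylinder over [D = gamma r D0].  As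
    [gamma s D0] agrees with [D] for almost every [s], two such values that
    differ by a prescribed [t] give the invariance of [D] under [gamma t]. *)
Lemma skew_invariant_set (A : set (X * W)) :
  invariant_set (mu \x xi)%E (skew_action a omega gamma) A ->
  exists2 D, invariant_set xi gamma D &
    {ae (mu \x xi)%E, forall z, A z <-> D z.2}.
Proof.
move=> [mA invA].
have mB := measurable_preimage measurable_unroll mA.
have [|D0 mD0 BD0] := @invariant_product_set _ _ _ _ _ (mu \xs @exp_measure R) xi
    _ _ _ hG maharam_ergodic mB.
  move=> g; apply: filterS (ae_unroll (invA g)) => -[[x r] w].
  by rewrite /unroll /skew_action /maharam /= gammaD.
have {}BD0 : {ae @exp_measure R, forall r : measurableTypeR R, {ae mu, forall x,
    {ae xi, forall w, A (x, gamma r w) <-> D0 w}}}.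
  by move: BD0 => /ae_sections/ae_sections_swap.
have [r Dr] := ae_exists (exp_measure_setT_neq0 R) BD0.
pose D := gamma (- r) @^-1` D0.
have mD : measurable D by exact: measurable_preimage.
have AD : {ae mu, forall x, {ae xi, forall w, A (x, w) <-> D w}}.
  apply: filterS Dr => x /(ae_flow (- r)).
  by apply: filterS => w; rewrite -gammaD subrr gamma0.
exists D; last first.
  apply: sections_ae => //.
  by apply: measurable_iff => //; exact: (measurable_preimage measurable_snd mD).
have DD0 : {ae @exp_measure R, forall r : measurableTypeR R,
    {ae xi, forall w, D (gamma r w) <-> D0 w}}.
  apply: filterS BD0 => s Ds.
  have mu1 : (mu setT != 0)%E by rewrite probability_setT onee_eq0.
  have : {ae mu, forall x, {ae xi, forall w, D (gamma s w) <-> D0 w}}.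
    apply: filterS2 AD Ds => x /(ae_flow s); apply: filterS2 => w.
    by move=> <-.
  by move=> /(ae_exists mu1)[].
split=> // t.
have [s [Ds]] : exists s, {ae xi, forall w, D (gamma s w) <-> D0 w} /\
    {ae xi, forall w, D (gamma (t + s) w) <-> D0 w}.
  apply: (ae_exists (exp_measure_setT_neq0 R)).
  by apply: filterS2 DD0 (exp_measure_ae_translation t DD0) => s.
move=> Dts.
have /(ae_flow (- s)) : {ae xi, forall w, D (gamma t (gamma s w)) <-> D (gamma s w)}.
  by apply: filterS2 Ds Dts => w Ds; rewrite gammaD Ds.
by apply: filterS => w; rewrite -(gammaD s) subrr gamma0.
Qed.

(** The preceding lemma for maps instead of sets.  The induced map on [W] is a
    section [q (x0, _)] at one generic point, which makes its measurability
    immediate. *)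
Lemma skew_invariant_map d (Z : measurableType d) (B : nat -> set Z)
    (q : X * W -> Z) :
  (forall n, measurable (B n)) ->
  (forall z z', (forall n, B n z <-> B n z') -> z = z') ->
  measurable_fun setT q ->
  (forall g, {ae (mu \x xi)%E, forall z, q (skew_action a omega gamma g z) = q z}) ->
  exists p : W -> Z, [/\ measurable_fun setT p,
    {ae (mu \x xi)%E, forall z, q z = p z.2} &
    forall t, {ae xi, forall w, p (gamma t w) = p w}].
Proof.
move=> mB sepB mq invq.
have /choice[D DP] n : exists D, invariant_set xi gamma D /\
    {ae (mu \x xi)%E, forall z, B n (q z) <-> D z.2}.
  have [|D ? ?] := @skew_invariant_set (q @^-1` B n); last by exists D.
  split; first exact: measurable_preimage.
  by move=> g; apply: filterS (invq g) => z /= ->.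
have {}DP : (forall n, invariant_set xi gamma (D n)) /\
    {ae (mu \x xi)%E, forall z, forall n, B n (q z) <-> D n z.2}.
  split=> [n|]; first by have [] := DP n.
  by apply: ae_foralln => n; have [] := DP n.
have [invD qD] := DP.
have mu1 : (mu setT != 0)%E by rewrite probability_setT onee_eq0.
have [x0 /= qx0] := ae_exists mu1 (ae_sections qD).
exists (fun w => q (x0, w)); split.
- exact: measurable_fun_pair2.
- apply: filterS2 qD (ae_snd mu qx0) => -[x w] /= qxw qx0w.
  by apply: sepB => n; rewrite qxw qx0w.
- move=> t.
  have : {ae xi, forall w, forall n, D n (gamma t w) <-> D n w}.
    by apply: ae_foralln => n; have [_] := invD n; exact.
  apply: filterS3 qx0 (ae_flow t qx0) => w qw qtw Dw.
  by apply: sepB => n; rewrite qw qtw Dw.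
Qed.

(** The map [q] factors through [W] by the preceding lemma, and the induced map
    [p] is fine enough: a set invariant under the flow is the base of a cylinder
    invariant under the skew action, to which the hypothesis on [q] applies. *)
Lemma skew_ergodic_components d (Z : measurableType d)
    (zeta : {measure set Z -> \bar R}) (q : X * W -> Z) :
  (forall g, measurable_fun [set: X] (omega g)) -> standard_borel R Z ->
  ergodic_components (mu \x xi)%E (skew_action a omega gamma) zeta q ->
  exists2 p : W -> Z, ergodic_components xi gamma zeta p &
    {ae (mu \x xi)%E, forall z, q z = p z.2}.
Proof.
move=> momega /standard_borel_separated[B [mB sepB]] [mq invq nullq compq].
have mu1 : (mu setT != 0)%E by rewrite probability_setT onee_eq0.
have [p [mp qp invp]] := skew_invariant_map mB sepB mq invq.
exists p => //; split => // [D mD|A [mA invA]].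
  rewrite (nullq D mD).
  rewrite (ae_measurable0 (mu \x xi)%E (measurable_preimage mq mD)).
  rewrite (ae_measurable0 xi (measurable_preimage mp mD)).
  split=> [aeD|/(ae_snd mu) aeD]; last by apply: filterS2 qp aeD => z /= ->.
  by apply: (ae_snd_inv (m1 := mu) mu1); apply: filterS2 qp aeD => z /= ->.
have mA' := measurable_preimage (@measurable_snd _ _ X W) mA.
have [|D mD AD] := compq (snd @^-1` A).
  split=> // g; apply: sections_ae.
    apply: measurable_iff => //; apply: (measurable_preimage _ mA).
    by apply: mgamma2 => //; exact: measurableT_comp.
  by apply: aeW => x; exact: (invA (omega g x)).
exists D => //; apply: (ae_snd_inv (m1 := mu) mu1).
by apply: filterS2 qp AD => z /= <-.
Qed.

End SkewInvariant.

(** * Densities *)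

Section Densities.
Context (R : realType) d (T : measurableType d).
Local Open Scope ereal_scope.

Import HBNNSimple.

Lemma ge0_integral_density (m nu : {measure set T -> \bar R}) (f : T -> R)
    (h : T -> \bar R) :
  measurable_fun setT f -> (forall x, 0 <= f x)%R ->
  (forall A, measurable A -> nu A = \int[m]_(x in A) (f x)%:E) ->
  measurable_fun setT h -> (forall x, 0 <= h x) ->
  \int[nu]_x h x = \int[m]_x (h x * (f x)%:E).
Proof.
move=> mf f0 nuE mh h0; pose s := nnsfun_approx measurableT mh.
have mEf : measurable_fun setT (EFin \o f) by exact/measurable_EFinP.
have ms n : measurable_fun setT (EFin \o s n) by exact/measurable_EFinP.
have ndE x : nondecreasing_seq (fun n => (s n x)%:E).
  by move=> i j ij; rewrite lee_fin; exact/lefP/nd_nnsfun_approx.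
have sh x : (s n x)%:E @[n --> \oo] --> h x by exact: cvg_nnsfun_approx.
have s_density n : \int[nu]_x (s n x)%:E = \int[m]_x ((s n x)%:E * (f x)%:E).
  transitivity (\int[nu]_x (\sum_(y \in range (s n))
      (y * \1_(s n @^-1` [set y]) x)%:E)).
    by apply: eq_integral => x _; rewrite [in LHS]fimfunE -fsumEFin.
  rewrite ge0_integral_fsum//; last 2 first.
  - by move=> y; apply/measurable_EFinP; exact: measurable_funM.
  - by move=> y x _; exact: nnfun_muleindic_ge0.
  transitivity (\int[m]_x (\sum_(y \in range (s n))
      (y * \1_(s n @^-1` [set y]) x)%:E * (f x)%:E)).
    rewrite ge0_integral_fsum//; last 2 first.
    - move=> y; apply: emeasurable_funM => //.
      by apply/measurable_EFinP; exact: measurable_funM.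
    - by move=> y x _; apply: mule_ge0; [exact: nnfun_muleindic_ge0|rewrite lee_fin].
    apply: eq_fsbigr => y /[!inE] -[x _ <-].
    under eq_integral do rewrite EFinM.
    under [RHS]eq_integral do rewrite EFinM -muleA.
    have mi : measurable_fun setT
        (fun z => (\1_(s n @^-1` [set s n x]) z : R)%:E).
      exact/measurable_EFinP.
    have mif : measurable_fun setT
        (fun z => (\1_(s n @^-1` [set s n x]) z : R)%:E * (f z)%:E).
      exact: emeasurable_funM.
    rewrite [LHS]ge0_integralZl ?lee_fin// [RHS]ge0_integralZl ?lee_fin//; last first.
      by move=> z _; rewrite mule_ge0// lee_fin.
    congr (_ * _); rewrite integral_indic// setIT nuE//.
    rewrite integral_mkcond; apply: eq_integral => z _.
    by rewrite epatch_indic muleC.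
  apply: eq_integral => x _; rewrite -ge0_mule_fsuml => [|y].
    by rewrite [in RHS](fimfunE (s n)) -fsumEFin.
  exact: nnfun_muleindic_ge0.
transitivity (limn (fun n => \int[nu]_x (s n x)%:E)).
  rewrite -monotone_convergence//; last by move=> n x _; rewrite lee_fin.
  by apply: eq_integral => x _; apply/esym/cvg_lim.
under eq_fun do rewrite s_density.
rewrite -monotone_convergence//.
- apply: eq_integral => x _; apply/cvg_lim => //.
  by apply: cvgeZr.
- by move=> n; exact: emeasurable_funM (ms n) mEf.
- by move=> n x _; rewrite mule_ge0 ?lee_fin.
- by move=> x _ i j ij; rewrite lee_wpmul2r ?lee_fin//; exact: ndE.
Qed.

(** Uniqueness is local: the space is a countable union of sets of finite
    measure on which [f] is bounded, hence integrable. *)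
Lemma ae_eq_density (m : {sigma_finite_measure set T -> \bar R})
    (f g : T -> R) :
  measurable_fun setT f -> measurable_fun setT g ->
  (forall x, 0 <= f x)%R -> (forall x, 0 <= g x)%R ->
  (forall A, measurable A ->
    \int[m]_(x in A) (f x)%:E = \int[m]_(x in A) (g x)%:E) ->
  {ae m, forall x, f x = g x}.
Proof.
move=> mf mg f0 g0 fg.
have [F UF Foo] := sigma_finiteT m.
pose K n k := F n `&` [set x | (f x <= k%:R)%R].
have mK n k : measurable (K n k).
  apply: measurableI; first by have [] := Foo n.
  rewrite -[X in measurable X]setTI.
  by apply: measurable_fun_le => //; exact: measurable_cst.
have Kfg n k : {ae m, forall x, K n k x -> (f x)%:E = (g x)%:E}.
  apply: integral_ae_eq => //.
  - apply/integrableP; split; first exact/measurable_funTS/measurable_EFinP.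
    apply: (@le_lt_trans _ _ (\int[m]_(x in K n k) k%:R%:E)).
      apply: ge0_le_integral => //.
      + exact/measurable_funTS/measurableT_comp/measurable_EFinP.
      + by move=> x [_ /=]; rewrite lee_fin ger0_norm.
    rewrite integral_cst// lte_mul_pinfty ?lee_fin//.
    have [mF] := Foo n; apply: le_lt_trans.
    by apply: le_measure; rewrite ?inE//; exact: subIsetl.
  - exact/measurable_funTS/measurable_EFinP.
  - by move=> E _ mE; exact: fg.
have : {ae m, forall x, forall n k, K n k x -> (f x)%:E = (g x)%:E}.
  by apply: ae_foralln => n; exact: ae_foralln.
apply: filterS => x Kx.
have [n _ Fnx] : (\bigcup_n F n) x by rewrite -UF.
suff [] : (f x)%:E = (g x)%:E by [].
apply: (Kx n (Num.truncn (f x)).+1); split => //=.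
exact/ltW/truncnS_gt.
Qed.

(** To be applied with [f] the inverse of an element of a group or flow, [w]
    being then the logarithmic Radon-Nikodym derivative of that element. *)
Lemma ge0_integral_comp_density (m : {measure set T -> \bar R}) (f : T -> T)
    (w : T -> R) (h : T -> \bar R) :
  measurable_fun setT f -> measurable_fun setT w ->
  (forall A, measurable A ->
    pushforward m f A = \int[m]_(x in A) (expR (w x))%:E) ->
  measurable_fun setT h -> (forall x, 0 <= h x) ->
  \int[m]_x h (f x) = \int[m]_x (h x * (expR (w x))%:E).
Proof.
move=> mf mw fE mh h0.
have mexp : measurable_fun setT (fun x => expR (w x)) by exact: measurableT_comp.
rewrite -(ge0_integral_pushforward mf m measurableT mh (fun y _ => h0 y)).
exact: (ge0_integral_density mexp (fun x => expR_ge0 _) fE mh h0).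
Qed.

End Densities.

(** * Products of standard Borel spaces *)

Section ProductComplete.
Context (U V : completeType).

HB.instance Definition _ := Pointed.on (U * V)%type.

Lemma prod_cauchy_cvg (F : set_system (U * V)) :
  ProperFilter F -> cauchy F -> cvg F.
Proof.
move=> FF cF.
have /cauchy_cvg cU : cauchy (fst @ F).
  move=> A entA; have [[B C] [/= FB FC] BCA] := cF _ (prod_entP entA filterT).
  exists (fst @` B, fst @` C).
    by split; [apply: filterS FB|apply: filterS FC] => z ?; exists z.
  by move=> [_ _] [/= [z Bz <-] [z' Cz' <-]]; have [] := BCA (z, z') (conj Bz Cz').
have /cauchy_cvg cV : cauchy (snd @ F).
  move=> A entA; have [[B C] [/= FB FC] BCA] := cF _ (prod_entP filterT entA).
  exists (snd @` B, snd @` C).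
    by split; [apply: filterS FB|apply: filterS FC] => z ?; exists z.
  by move=> [_ _] [/= [z Bz <-] [z' Cz' <-]]; have [] := BCA (z, z') (conj Bz Cz').
apply/cvg_ex; exists (lim (fst @ F), lim (snd @ F)) => N [[A B] [/= nA nB] ABN].
have FA : F (fst @^-1` A) := cU _ nA.
have FB : F (snd @^-1` B) := cV _ nB.
by apply: filterS (filterI FA FB) => z [Az Bz]; exact: ABN.
Qed.

HB.instance Definition _ := Uniform_isComplete.Build (U * V)%type prod_cauchy_cvg.

End ProductComplete.

HB.instance Definition _ (R : realType) (U V : completePseudoMetricType R) :=
  Complete.on (U * V)%type.

Section StandardBorelProduct.
Context (R : realType).

Lemma hausdorff_prod (U V : topologicalType) :
  hausdorff_space U -> hausdorff_space V -> hausdorff_space (U * V)%type.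
Proof.
move=> hU hV [u v] [u' v'] cl; congr (_, _).
  apply: hU => A B nA nB.
  have [z [Az Bz]] := cl (fst @^-1` A) (fst @^-1` B) (cvg_fst nA) (cvg_fst nB).
  by exists z.1.
apply: hV => A B nA nB.
have [z [Az Bz]] := cl (snd @^-1` A) (snd @^-1` B) (cvg_snd nA) (cvg_snd nB).
by exists z.2.
Qed.

Lemma basis_prod (U V : topologicalType) (B : set (set U)) (C : set (set V)) :
  basis B -> basis C -> basis [set b.1 `*` b.2 | b in B `*` C].
Proof.
move=> [oB bB] [oC bC]; split.
  move=> _ [[b c] [/= /oB ob /oC oc] <-]; rewrite openE => -[u v] [/= bu cv].
  by exists (b, c) => //; split; exact: open_nbhs_nbhs.
move=> [u v] N [[A A'] [/= nA nA'] AA'N].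
have [b [Bb bu] bA] := bB u A nA; have [c [Cc cv] cA'] := bC v A' nA'.
exists (b `*` c); first by split => //; exists (b, c).
by move=> z [/bA Az /cA' A'z]; exact: AA'N.
Qed.

Lemma second_countable_prod (U V : topologicalType) :
  @second_countable U -> @second_countable V -> @second_countable (U * V)%type.
Proof.
move=> [B cB bB] [C cC bC]; exists [set b.1 `*` b.2 | b in B `*` C].
  by apply: (sub_countable (card_image_le _ _)); exact: countableX.
exact: basis_prod.
Qed.

Lemma second_countable_real : @second_countable R.
Proof.
exists [set `](ratr q.1 : R), ratr q.2[%classic | q in [set: rat * rat]].
  by apply: (sub_countable (card_image_le _ _)); exact: countableP.
split; first by move=> _ [q _ <-]; exact: interval_open.
move=> x N /nbhs_ballP[e /= e0 eN].
have /rat_in_itvoo[p /itvP px] : x - e < x by rewrite ltrBlDr ltrDl.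
have /rat_in_itvoo[q /itvP qx] : x < x + e by rewrite ltrDl.
exists `](ratr p : R), ratr q[%classic.
  by split; [exists (p, q)|rewrite /= in_itv/= px qx].
move=> y /=; rewrite in_itv/= => /andP[py yq]; apply: eN.
rewrite /ball/= ltr_distlC (lt_trans _ py) ?px//=.
by rewrite (lt_trans yq)// qx.
Qed.

Lemma standard_borel_real : standard_borel R (measurableTypeR R).
Proof.
exists R, id; split.
- exact: Rhausdorff.
- exact: second_countable_real.
- by exists id.
- move=> B; split=> [|mB].
    apply: smallest_sub; first exact: sigma_algebra_measurable.
    by move=> U; exact: open_measurable.
  have : (@RGenOpens.G R).-sigma.-measurable B by rewrite -RGenOpens.measurableE.
  apply: smallest_sub; first exact: smallest_sigma_algebra.
  by move=> _ [x [y ->]]; apply: sub_sigma_algebra; exact: interval_open.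
Qed.

Lemma countable_bigcup_measurable d (T : measurableType d) (I : pointedType)
    (D : set I) (F : I -> set T) :
  countable D -> (forall i, D i -> measurable (F i)) ->
  measurable (\bigcup_(i in D) F i).
Proof.
move=> cD mF.
have /pfcard_geP[->|[g]] : (D #<= [set: nat])%card := cD.
  by rewrite bigcup_set0.
have -> : \bigcup_(i in D) F i = \bigcup_n F (g n).
  apply/seteqP; split=> x [i].
    by move=> Di Fx; have [n _ gn] := surj (f := g) Di; exists n; rewrite ?gn.
  by move=> _ Fx; exists (g i) => //; exact: funS.
by apply: bigcupT_measurable => n; apply: mF; exact: funS.
Qed.

(** Second countability writes an open set of the product as a countable union
    of open rectangles; this is what makes the Borel sets of the product agree
    with the product of the Borel sets. *)
Lemma open_measurable_prod (P1 P2 : ptopologicalType) d1 d2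
   (T1 : measurableType d1) (T2 : measurableType d2)
   (f1 : T1 -> P1) (f2 : T2 -> P2) (U : set (P1 * P2)) :
  @second_countable P1 -> @second_countable P2 ->
  (forall V, open V -> measurable (f1 @^-1` V)) ->
  (forall V, open V -> measurable (f2 @^-1` V)) ->
  open U -> measurable ((fun z => (f1 z.1, f2 z.2)) @^-1` U).
Proof.
move=> [B cB bB] [C cC bC] mf1 mf2 oU.
have -> : (fun z => (f1 z.1, f2 z.2)) @^-1` U =
   \bigcup_(b in (B `*` C) `&` [set b | b.1 `*` b.2 `<=` U])
     ((f1 @^-1` b.1) `*` (f2 @^-1` b.2)).
  apply/seteqP; split=> [[x y] /= Uxy|[x y] [[b c] [_ bU] [/= bx cy]]]; last first.
    by apply: bU.
  have [_ [[[b c] bc <-] [/= bx cy] bcU]] :=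
    (basis_prod bB bC).2 _ _ (open_nbhs_nbhs (conj oU Uxy)).
  by exists (b, c).
apply: countable_bigcup_measurable.
  exact: (sub_countable (subset_card_le (@subIsetl _ _ _)) (countableX cB cC)).
move=> [b c] [[/= /(bB.1) ob /(bC.1) oc] _].
by apply: measurableX; [exact: mf1|exact: mf2].
Qed.

Lemma standard_borel_prod d1 d2 (T1 : measurableType d1)
    (T2 : measurableType d2) :
  standard_borel R T1 -> standard_borel R T2 -> standard_borel R (T1 * T2)%type.
Proof.
move=> [P1 [f1 [h1 c1 [g1 fK1 gK1] b1]]] [P2 [f2 [h2 c2 [g2 fK2 gK2] b2]]].
have mf : forall U, open U -> measurable ((fun z => (f1 z.1, f2 z.2)) @^-1` U).
  move=> U; apply: open_measurable_prod => // V oV.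
  - by apply/b1; exact: sub_sigma_algebra.
  - by apply/b2; exact: sub_sigma_algebra.
pose B12 : measurableType _ := g_sigma_algebraType (@open (P1 * P2)%type).
(* [mcont] for the projections and [minv] for the inverse charts of the factors
   give the measurability of the inverse of the product chart. *)
have mcont (P : ptopologicalType) (h : P1 * P2 -> P) : continuous h ->
    @measurable_fun _ _ B12 (g_sigma_algebraType (@open P)) setT h.
  move=> ch; apply: (@measurability _ _ B12 (g_sigma_algebraType (@open P)) setT h
    (@open P)) => // _ [U oU <-].
  rewrite setTI; apply: sub_sigma_algebra.
  by apply: open_comp => // z _; exact: ch.
have minv (P : ptopologicalType) d (T : measurableType d)
    (f : T -> P) (g : P -> T) : cancel f g ->
    (forall B : set P, <<s @open P >> B <-> measurable (f @^-1` B)) ->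
    @measurable_fun _ _ (g_sigma_algebraType (@open P)) T setT g.
  move=> fK bf _ A mA; rewrite setTI; apply/bf.
  by rewrite -comp_preimage (_ : g \o f = id)//; apply/funext.
have mg : @measurable_fun _ _ B12 _ setT (fun p => (g1 p.1, g2 p.2)).
  apply: measurable_fun_pair.
  - apply: (@measurableT_comp _ _ _ B12 (g_sigma_algebraType (@open P1)) T1
      g1 setT fst).
      exact: (minv _ _ _ f1).
    by apply: mcont => z; exact: cvg_fst.
  - apply: (@measurableT_comp _ _ _ B12 (g_sigma_algebraType (@open P2)) T2
      g2 setT snd).
      exact: (minv _ _ _ f2).
    by apply: mcont => z; exact: cvg_snd.
exists (P1 * P2)%type, (fun z => (f1 z.1, f2 z.2)); split.
- exact: hausdorff_prod.
- exact: second_countable_prod.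
- exists (fun p => (g1 p.1, g2 p.2)) => -[x y] /=; first by rewrite fK1 fK2.
  by rewrite gK1 gK2.
- move=> B; split=> [mB|mB].
    have : @measurable_fun _ _ _ B12 setT (fun z => (f1 z.1, f2 z.2)).
      apply: (@measurability _ _ _ B12 setT _ (@open (P1 * P2)%type)) => //.
      by move=> _ [U oU <-]; rewrite setTI; exact: mf.
    by move=> /measurable_preimage; exact.
  have := measurable_preimage mg mB.
  rewrite -comp_preimage (_ : _ \o _ = id)//.
  by apply/funext => -[x y] /=; rewrite gK1 gK2.
Qed.

End StandardBorelProduct.

(** * The action of the plane attached to a flow *)

Section FlowPlane.
Context (R : realType) (dY : measure_display) (Y : measurableType dY)
  (eta : {sigma_finite_measure set Y -> \bar R})
  (alpha : R -> Y -> Y) (beta : R -> Y -> R).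
Hypothesis halpha : nonsingular_flow eta alpha.
Hypothesis hbeta : flow_log_RN_cocycle eta alpha beta.

Let W : measurableType _ := (Y * measurableTypeR R)%type.
Let xi : {sigma_finite_measure set W -> \bar R} := eta \xs @exp_measure R.

(** The first coordinate acts by the Maharam extension of [alpha] followed by
    the vertical translation by [u.1], which makes it scale the measure; the
    second coordinate acts by vertical translations. *)
Definition flow_plane (u : R * R) (w : Y * measurableTypeR R) :
    Y * measurableTypeR R :=
  (alpha u.1 w.1, u.1 + u.2 + beta u.1 w.1 + w.2).

Let alpha0 y : alpha 0 y = y. Proof. by case: halpha. Qed.
Let alphaD s t y : alpha (s + t) y = alpha s (alpha t y).
Proof. by case: halpha. Qed.
Let betaD s t y : beta (s + t) y = beta s (alpha t y) + beta t y.
Proof. by case: hbeta. Qed.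
Let beta0 y : beta 0 y = 0.
Proof.
have /eqP := betaD 0 0 y.
by rewrite addr0 alpha0 -subr_eq subrr eq_sym => /eqP.
Qed.

Let malpha d (T : measurableType d) (f : T -> R) (h : T -> Y) :
  measurable_fun setT f -> measurable_fun setT h ->
  measurable_fun setT (fun z => alpha (f z) (h z)).
Proof.
case: halpha => _ _ _ ma _ mf mh.
exact: (measurableT_comp ma (measurable_fun_pair mf mh)).
Qed.

Let mbeta d (T : measurableType d) (f : T -> R) (h : T -> Y) :
  measurable_fun setT f -> measurable_fun setT h ->
  measurable_fun setT (fun z => beta (f z) (h z)).
Proof.
case: hbeta => mb _ _ mf mh.
exact: (measurableT_comp mb (measurable_fun_pair mf mh)).
Qed.

Let measurable_flow_plane d (T : measurableType d) (f g : T -> R) (h : T -> W) :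
  measurable_fun setT f -> measurable_fun setT g -> measurable_fun setT h ->
  measurable_fun setT (fun z => flow_plane (f z, g z) (h z)).
Proof.
move=> mf mg mh.
have mh1 : measurable_fun setT (fun z => (h z).1) by exact: measurableT_comp.
have mh2 : measurable_fun setT (fun z => (h z).2) by exact: measurableT_comp.
apply: measurable_fun_pair => /=; first exact: malpha.
apply: measurable_funD => //; apply: measurable_funD; first exact: measurable_funD.
exact: mbeta.
Qed.

Lemma flow_plane0 w : flow_plane 0 w = w.
Proof. by case: w => y s; rewrite /flow_plane /= alpha0 beta0 !add0r. Qed.

Lemma flow_plane_vertical t w : flow_plane (0, t) w = (w.1, t + w.2).
Proof. by rewrite /flow_plane /= alpha0 beta0 add0r addr0. Qed.

Lemma flow_planeD u v w : flow_plane (u + v) w = flow_plane u (flow_plane v w).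
Proof.
case: u v w => [u1 u2] [v1 v2] [y s]; rewrite /flow_plane /= alphaD betaD.
by congr (_, _); lra.
Qed.

(** The vertical translation by [u.1 + u.2 + beta] multiplies the measure of a
    fibre by its exponential, and the factor [expR beta] is absorbed by the
    substitution along [alpha]. *)
Lemma flow_plane_scales u (A : set W) : measurable A ->
  pushforward xi (flow_plane u) A = ((expR (u.1 + u.2))%:E * xi A)%E.
Proof.
move=> mA; case: u => t u /=.
pose h y := @exp_measure R (xsection A y).
have mh : measurable_fun setT h by exact: measurable_fun_xsection.
have h0 y : (0 <= h y)%E by exact: measure_ge0.
have mbt : measurable_fun setT (beta t) by exact: mbeta.
have mat : measurable_fun setT (alpha t) by exact: malpha.
have maNt : measurable_fun setT (alpha (- t)) by exact: malpha.
have -> : pushforward xi (flow_plane (t, u)) A =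
    (\int[eta]_y ((expR (t + u))%:E * (h (alpha t y) * (expR (beta t y))%:E)))%E.
  apply: eq_integral => y _ /=.
  have := exp_measure_translation (t + u + beta t y)
    (measurable_xsection (alpha t y) mA).
  rewrite expRD EFinM muleAC -muleA => <-.
  by congr (exp_measure _).
rewrite ge0_integralZl//; last 2 first.
- apply: emeasurable_funM; first exact: measurableT_comp.
  by apply/measurable_EFinP; exact: measurableT_comp.
- by move=> y _; rewrite mule_ge0.
congr (_ * _)%E.
have RN A' : measurable A' -> pushforward eta (alpha (- t)) A' =
    (\int[eta]_(y in A') (expR (beta t y))%:E)%E.
  by case: hbeta => _ _; apply.
have mht : measurable_fun setT (fun y => h (alpha t y)) by exact: measurableT_comp.
rewrite -(ge0_integral_comp_density maNt mbt RN mht (fun y => h0 _)).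
by apply: eq_integral => y _ /=; rewrite -alphaD subrr alpha0.
Qed.

Lemma flow_plane_null : preserves_null_sets xi flow_plane.
Proof.
move=> u A mA; have E := flow_plane_scales u mA.
split=> A0; last by apply: etrans E _; rewrite [X in (_ * X)%E]A0 mule0.
move: (etrans (esym E) A0) => {E A0}/eqP.
by rewrite mule_eq0 eqe gt_eqF ?expR_gt0//= => /eqP.
Qed.

(** The group of translations is uncountable, so invariance holds off a null
    set that depends on the translation.  Fubini turns it into the statement
    that in almost every fibre almost all points behave like one of them. *)
Lemma vertical_invariant_set (A : set W) :
  invariant_set xi (fun t => flow_plane (0, t)) A ->
  exists2 D, measurable D & {ae xi, forall w, A w <-> D w.1}.
Proof.
move=> [mA invA].
pose A' := [set z : measurableTypeR R * Y | A (z.2, z.1)].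
have mA' : measurable A'.
  apply: (measurable_preimage _ mA).
  exact: measurable_fun_pair.
have [|D mD A'D] := @fiberwise_trivial_set R _ _ _ _ (@exp_measure R) eta A' mA'.
  have : {ae (xi \x @exp_measure R)%E, forall z,
      A (z.1.1, z.2 + z.1.2) <-> A z.1}.
    apply: sections_ae_swap.
      apply: measurable_iff.
        apply: (measurable_preimage (f := fun z : W * measurableTypeR R =>
          (z.1.1, z.2 + z.1.2) : W) _ mA).
        apply: measurable_fun_pair; first exact: measurableT_comp.
        by apply: measurable_funD => //; exact: measurableT_comp.
      exact: (measurable_preimage measurable_fst mA).
    apply: aeW => t; apply: filterS (invA t) => -[y s].
    by rewrite /flow_plane/= alpha0 beta0 add0r addr0.
  move=> /ae_assocl/ae_sections; apply: filterS => y /ae_sections Ay.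
  have [s Ays] := ae_exists (exp_measure_setT_neq0 R) Ay.
  have {}Ays : {ae @exp_measure R, forall r : measurableTypeR R, A (y, r) <-> A (y, s)}.
    apply: filterS (exp_measure_ae_translation (- s) Ays) => r /=.
    by rewrite addrAC addNr add0r.
  have [As|nAs] := pselect (A (y, s)); [left|right]; apply: filterS Ays => r Ar.
    by apply/Ar.
  by move=> /Ar.
exists D => //.
by have /ae_swap := A'D; apply: filterS => -[].
Qed.

Lemma flow_plane_nonsingular : nonsingular_plane_action xi flow_plane.
Proof.
split.
- apply: standard_borel_prod; last exact: standard_borel_real.
  by case: halpha.
- exact: flow_plane0.
- exact: flow_planeD.
- apply: measurable_flow_plane => //.
  + exact: (measurableT_comp measurable_fst measurable_fst).
  + exact: (measurableT_comp measurable_snd measurable_fst).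
- exact: flow_plane_null.
Qed.

Lemma flow_plane_vertical_quotient :
  quotient_flow xi (fun t => flow_plane (0, t)) (fun t => flow_plane (t, 0))
    eta alpha.
Proof.
split=> //; exists fst; split; last by move=> t; apply: aeW.
split.
- exact: measurable_fst.
- by move=> t; apply: aeW => -[y s]; rewrite /flow_plane/= alpha0.
- move=> B mB.
  have mB' := measurable_preimage (@measurable_fst _ _ Y (measurableTypeR R)) mB.
  rewrite (ae_measurable0 eta mB) (ae_measurable0 xi mB').
  split; first exact: ae_fst.
  exact: (ae_fst_inv (exp_measure_setT_neq0 R)).
- move=> A /vertical_invariant_set[D mD AD]; by exists D.
Qed.

(** By invariance under the second coordinate an invariant set is a cylinder, and
    by invariance under the first one its base is invariant under [alpha]. *)
Lemma flow_plane_ergodic : ergodic eta alpha -> ergodic xi flow_plane.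
Proof.
move=> erg A [mA invA].
have [D mD AD] : exists2 D, measurable D & {ae xi, forall w, A w <-> D w.1}.
  by apply: vertical_invariant_set; split => // t.
have /erg [aeD|aeD] : invariant_set eta alpha D.
- split=> // t.
  have : {ae xi, forall w, D (alpha t w.1) <-> D w.1}.
    have ADt : {ae xi, forall w, A (flow_plane (t, 0) w) <-> D (alpha t w.1)}.
      have m1 : measurable_fun setT (flow_plane (t, 0)) by exact: measurable_flow_plane.
      apply: (ae_pullback m1 _ AD) => B mB B0; exact/flow_plane_null.
    by apply: filterS3 AD ADt (invA (t, 0)) => w <- <-.
  exact: (ae_fst_inv (exp_measure_setT_neq0 R)).
- left; apply: filterS2 AD (ae_fst _ aeD) => w AD Dw; exact/AD.
- right; apply: filterS2 AD (ae_fst _ aeD) => w AD Dw; exact/AD.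
Qed.

End FlowPlane.

(** * Nonsingularity and Radon-Nikodym cocycle of the skew action *)

Section SkewProduct.
Context (R : realType) (G : groupType)
  (dX : measure_display) (X : measurableType dX)
  (mu : {sigma_finite_measure set X -> \bar R}) (a : G -> X -> X)
  (omega : G -> X -> R).
Hypothesis ha : nonsingular_action mu a.
Hypothesis homega : log_RN_cocycle mu a omega.
Context (dY : measure_display) (Y : measurableType dY)
  (eta : {sigma_finite_measure set Y -> \bar R})
  (alpha : R -> Y -> Y) (beta : R -> Y -> R).
Hypothesis halpha : nonsingular_flow eta alpha.

Let T := skew_action a omega alpha.

Let ma g : measurable_fun setT (a g). Proof. by case: ha. Qed.
Let momega g : measurable_fun setT (omega g). Proof. by case: homega. Qed.
Let aM g h x : a (g * h)%g x = a g (a h x). Proof. by case: ha. Qed.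
Let omegaM g h x : omega (g * h)%g x = omega g (a h x) + omega h x.
Proof. by case: homega. Qed.
Let alphaD s t y : alpha (s + t) y = alpha s (alpha t y).
Proof. by case: halpha. Qed.

Let a1 x : a 1%g x = x. Proof. by case: ha. Qed.
Let omega1 x : omega 1%g x = 0.
Proof.
have /eqP := omegaM 1%g 1%g x.
by rewrite mulg1 a1 -subr_eq subrr eq_sym => /eqP.
Qed.

Let malpha d (S : measurableType d) (f : S -> R) (h : S -> Y) :
  measurable_fun setT f -> measurable_fun setT h ->
  measurable_fun setT (fun z => alpha (f z) (h z)).
Proof.
case: halpha => _ _ _ mal _ mf mh.
exact: (measurableT_comp mal (measurable_fun_pair mf mh)).
Qed.

Let mT g : measurable_fun setT (T g).
Proof.
apply: measurable_fun_pair; first exact: measurableT_comp.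
by apply: malpha => //; exact: measurableT_comp.
Qed.

Let TM g h z : T (g * h)%g z = T g (T h z).
Proof. by case: z => x y; rewrite /T /skew_action /= aM omegaM alphaD. Qed.

Let T1 z : T 1%g z = z.
Proof.
case: z => x y; rewrite /T /skew_action /= a1 omega1.
by case: halpha => _ -> .
Qed.

Lemma skew_action_nonsingular : nonsingular_action (mu \x eta)%E T.
Proof.
have null g A : measurable A -> (mu \x eta)%E A = 0%E ->
    (mu \x eta)%E (T g @^-1` A) = 0%E.
  apply: (@skew_product_null _ _ _ _ _ _ _ _ _ mu eta mu eta (a g)
    (fun x => alpha (omega g x))) => //.
  - by apply: malpha => //; exact: measurableT_comp.
  - by move=> B mB; case: ha => _ _ _ /(_ g B mB) [].
  - by move=> x B mB; case: halpha => _ _ _ _ /(_ (omega g x) B mB)[].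
split=> // g A mA; split=> [A0|]; last exact: null.
have := null g^-1%g _ (measurable_preimage (mT g) mA) A0.
suff -> : T g^-1%g @^-1` (T g @^-1` A) = A by [].
by apply/seteqP; split=> z /=; rewrite -TM mulgV T1.
Qed.

Hypothesis hbeta : flow_log_RN_cocycle eta alpha beta.

(** By uniqueness of densities it suffices that the right-hand side is also a
    logarithmic Radon-Nikodym derivative.  The substitution along [alpha] in the
    fibres produces the summand [beta], the one along [a] in the base produces
    [omega]. *)
Lemma skew_action_log_RN omega' g : log_RN_cocycle (mu \x eta)%E T omega' ->
  {ae (mu \x eta)%E, forall z,
    omega' g z = omega g z.1 + beta (omega g z.1) z.2}.
Proof.
move=> [momega' _ omega'E].
have mb d (S : measurableType d) (f : S -> R) (h : S -> Y) :
    measurable_fun setT f -> measurable_fun setT h ->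
    measurable_fun setT (fun z => beta (f z) (h z)).
  case: hbeta => mb _ _ mf mh.
  exact: (measurableT_comp mb (measurable_fun_pair mf mh)).
pose w (z : X * Y) := omega g z.1 + beta (omega g z.1) z.2.
have mbz : measurable_fun setT (fun z : X * Y => beta (omega g z.1) z.2).
  by apply: mb => //; exact: measurableT_comp.
have mw : measurable_fun setT w.
  by apply: measurable_funD => //; exact: measurableT_comp.
have momega'g : measurable_fun setT (omega' g) by exact: momega'.
suff : {ae (mu \xs eta), forall z, expR (omega' g z) = expR (w z)}.
  by apply: filterS => z /expR_inj.
apply: ae_eq_density.
- exact: measurableT_comp.
- exact: measurableT_comp.
- by move=> z; exact: expR_ge0.
- by move=> z; exact: expR_ge0.
move=> A mA; rewrite -omega'E//.
(* The integral of [f] over the fibre at [x] is the measure of the image under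
   [alpha (omega g x)] of the section of [A] at [x]. *)
pose f (z : X * Y) := ((\1_A z)%:E * (expR (beta (omega g z.1) z.2))%:E)%E.
have mf : measurable_fun setT f.
  by apply: emeasurable_funM; apply/measurable_EFinP => //; exact: measurableT_comp.
have f0 z : (0 <= f z)%E by rewrite mule_ge0// lee_fin expR_ge0.
pose k x := (\int[eta]_y f (x, y))%E.
have mk : measurable_fun setT k by exact: measurable_fun_fubini_tonelli_F.
have k0 x : (0 <= k x)%E by exact: integral_ge0.
have RN B : measurable B -> pushforward mu (a g^-1%g) B =
    (\int[mu]_(x in B) (expR (omega g x))%:E)%E.
  by case: homega => _ _; apply.
transitivity (\int[mu]_x k (a g^-1%g x))%E.
  apply: eq_integral => x _ /=.
  have mAx : measurable (xsection A (a g^-1%g x)) by exact: measurable_xsection.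
  have omegaV : omega g^-1%g x = - omega g (a g^-1%g x).
    by apply/eqP; rewrite -addr_eq0 addrC -omegaM mulgV omega1.
  have [_ _ /(_ (omega g (a g^-1%g x)) _ mAx) etaE] := hbeta.
  transitivity (pushforward eta (alpha (- omega g (a g^-1%g x)))
      (xsection A (a g^-1%g x))); first by rewrite -omegaV.
  rewrite etaE integral_mkcond; apply: eq_integral => y _.
  rewrite patchE mem_xsection /f indicE /=.
  by case: ifPn => _; rewrite ?mul1e ?mul0e.
rewrite (ge0_integral_comp_density (ma _) (momega g) RN mk k0).
have mh : measurable_fun setT (fun z => f z * (expR (omega g z.1))%:E)%E.
  apply: emeasurable_funM => //; apply/measurable_EFinP.
  by apply: measurableT_comp => //; exact: measurableT_comp.
have h0 z : (0 <= f z * (expR (omega g z.1))%:E)%E.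
  by rewrite mule_ge0// lee_fin expR_ge0.
transitivity (\int[(mu \x eta)%E]_z (f z * (expR (omega g z.1))%:E))%E.
  rewrite (fubini_tonelli1 _ mh h0); apply: eq_integral => x _.
  rewrite /fubini_F /= ge0_integralZr//.
  exact: measurable_fun_pair2.
rewrite [RHS]integral_mkcond; apply: eq_integral => z _.
rewrite patchE /f indicE /w expRD; case: ifPn => _; rewrite ?mul0e//.
by rewrite mul1e -EFinM mulrC.
Qed.

Let W : measurableType _ := (Y * measurableTypeR R)%type.
Let xi : {sigma_finite_measure set W -> \bar R} := eta \xs @exp_measure R.
Let first (t : R) : W -> W := flow_plane alpha beta (t, 0).
Let assocl (z : X * W) : (X * Y) * measurableTypeR R := ((z.1, z.2.1), z.2.2).

(** At time t = omega(g, x) the first coordinate of [flow_plane] adds to the real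
    variable t + beta(t, y), which is the value of the Radon-Nikodym cocycle of
    the skew action at (x, y). *)
Lemma maharam_skew_action omega' g :
  log_RN_cocycle (mu \x eta)%E T omega' ->
  {ae (mu \x xi)%E, forall z,
    maharam T omega' g (assocl z) = assocl (skew_action a omega first g z)}.
Proof.
move=> /(skew_action_log_RN g)/(ae_fst (m1 := mu \xs eta) (@exp_measure R)).
move=> /(ae_assocl (m1 := mu) (m2 := eta) (m3 := @exp_measure R)).
apply: filterS => -[x [y s]] /= oE.
by rewrite /assocl /maharam /first /flow_plane /= oE addr0.
Qed.

Lemma maharam_skew_components omega' d (Z : measurableType d)
    (zeta : {measure set Z -> \bar R}) q :
  log_RN_cocycle (mu \x eta)%E T omega' ->
  ergodic_components ((mu \xs eta) \x @exp_measure R)%E (maharam T omega')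
    zeta q ->
  ergodic_components (mu \x xi)%E (skew_action a omega first) zeta
    (fun z => q (assocl z)).
Proof.
move=> homega' [mq invq nullq compq].
pose assocr (z : (X * Y) * measurableTypeR R) : X * W := (z.1.1, (z.1.2, z.2)).
have massocl : measurable_fun setT assocl.
  apply: measurable_fun_pair; last exact: measurableT_comp.
  by apply: measurable_fun_pair => //; exact: measurableT_comp.
have massocr : measurable_fun setT assocr.
  apply: measurable_fun_pair; first exact: measurableT_comp.
  by apply: measurable_fun_pair => //; exact: measurableT_comp.
have mql : measurable_fun setT (fun z => q (assocl z)) by exact: measurableT_comp.
have ael P := @ae_assocl R _ _ _ _ _ _ mu eta (@exp_measure R) P.
have aer P := @ae_assocr R _ _ _ _ _ _ mu eta (@exp_measure R) P.
split=> // [g|D mD|A [mA invA]].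
- by apply: filterS2 (maharam_skew_action g homega') (ael _ (invq g)) => z <-.
- rewrite (nullq D mD).
  rewrite (ae_measurable0 _ (measurable_preimage mq mD)).
  rewrite (ae_measurable0 _ (measurable_preimage mql mD)).
  split=> [/ael//|/aer]; by apply: filterS => -[[x y] s].
- have [|D mD AD] := compq (assocr @^-1` A).
    split=> [|g]; first exact: measurable_preimage.
    have /aer := maharam_skew_action g homega'; have /aer := invA g.
    by apply: filterS2 => -[[x y] s] /= <- ->.
  by exists D => //; apply: filterS (ael _ AD) => -[x [y s]].
Qed.

End SkewProduct.

(** * The associated flow of the skew action *)

(** Type III_1 is ergodicity of the Maharam extension: a set of ergodic
    components that is a point leaves only null and conull invariant sets. *)
Lemma maharam_ergodic_of_III1 (R : realType) (G : groupType) d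
    (X : measurableType d) (mu : {measure set X -> \bar R}) (a : G -> X -> X)
    (omega : G -> X -> R) :
  type_III1 mu a omega -> ergodic (mu \x @exp_measure R)%E (maharam a omega).
Proof.
move=> [_ [p [[_ _ _ comp] _]]] A /comp[B _ AB].
have [Bt|nBt] := pselect (B tt); [left|right]; apply: filterS AB => x Ax.
  by apply/Ax; case: (p x).
by move=> /Ax; case: (p x).
Qed.

(** The action of the plane required by the definition of the adjoint flow is
    [flow_plane]: its quotient by the second coordinate is [alpha], and its
    quotient by the first one is the space of ergodic components of the Maharam
    extension of the skew action. *)
Lemma skew_associated_flow_adjoint (R : realType) (G : groupType)
    (dX : measure_display) (X : measurableType dX) (mu : probability X R)
    (a : G -> X -> X) (omega : G -> X -> R)
    (dY : measure_display) (Y : measurableType dY)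
    (eta : {sigma_finite_measure set Y -> \bar R})
    (alpha : R -> Y -> Y) (beta : R -> Y -> R) (omega' : G -> X * Y -> R)
    (dZ : measure_display) (Z : measurableType dZ)
    (zeta : {sigma_finite_measure set Z -> \bar R}) (phi : R -> Z -> Z) :
  countable [set: G] -> nonsingular_action mu a -> log_RN_cocycle mu a omega ->
  ergodic (mu \x @exp_measure R)%E (maharam a omega) ->
  nonsingular_flow eta alpha -> ergodic eta alpha ->
  flow_log_RN_cocycle eta alpha beta ->
  log_RN_cocycle (mu \x eta)%E (skew_action a omega alpha) omega' ->
  associated_flow (mu \x eta)%E (skew_action a omega alpha) omega' zeta phi ->
  adjoint_flow eta alpha zeta phi.
Proof.
move=> hG ha homega merg halpha erg hbeta homega' [hphi [q [compq eqv]]].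
pose W : measurableType _ := (Y * measurableTypeR R)%type.
pose xi : {sigma_finite_measure set W -> \bar R} := eta \xs @exp_measure R.
pose gamma := flow_plane alpha beta.
have gamma_ns : nonsingular_plane_action xi gamma by exact: flow_plane_nonsingular.
have [_ gamma0 gammaD mgamma gamma_null] := gamma_ns.
pose first t := gamma (t, 0).
have firstD s t w : first (s + t) w = first s (first t w).
  by rewrite /first -gammaD; congr (gamma (_, _) _); rewrite addr0.
have mfirst : measurable_fun setT (fun z : R * W => first z.1 z.2).
  apply: (measurableT_comp (f := fun z : (R * R) * W => gamma z.1 z.2)
    (g := fun z : R * W => ((z.1, 0), z.2)) mgamma).
  by apply: measurable_fun_pair => //; exact: measurable_fun_pair.
have first_null : preserves_null_sets xi first.
  by move=> t A mA; exact: (gamma_null (t, 0) A mA).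
have sbZ : standard_borel R Z by case: hphi.
have momega g : measurable_fun setT (omega g) by case: homega.
have [p comp_p qp] := skew_ergodic_components hG merg gamma0 firstD mfirst
  first_null momega sbZ (maharam_skew_components ha homega hbeta homega' compq).
exists _, W, xi, gamma; split.
- by split=> //; exact: flow_plane_ergodic.
- by move=> t A mA; rewrite flow_plane_scales//= addr0.
- by move=> t A mA; rewrite flow_plane_scales//= add0r.
- exact: flow_plane_vertical_quotient.
split=> //; exists p; split=> // t.
have mt : measurable_fun setT (gamma (0, t)).
  apply: (measurableT_comp (f := fun z : (R * R) * W => gamma z.1 z.2)
    (g := fun w : W => ((0, t), w)) mgamma).
  exact: measurable_fun_pair.
have mu1 : (mu setT != 0)%E by rewrite probability_setT onee_eq0.
(* Equivariance of [p] is equivariance of [q] read at one generic point [x]. *)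
have /ae_sections eqv_t :=
  ae_assocl (m1 := mu) (m2 := eta) (m3 := @exp_measure R) (eqv t).
have [x [/= qpx eqvx]] := ae_exists mu1 (filterI (ae_sections qp) eqv_t).
have qpt := ae_pullback mt (fun A mA => (gamma_null (0, t) A mA).2) qpx.
apply: filterS3 qpx qpt eqvx => -[y s] <- <-.
by rewrite /gamma (flow_plane_vertical halpha hbeta).
Qed.

Theorem proposition3p4 (R : realType) (G : groupType)
    (hG : countable [set: G])
    (dX : measure_display) (X : measurableType dX) (hX : standard_borel R X)
    (mu : probability X R) (a : G -> X -> X) (omega : G -> X -> R)
    (ha : nonsingular_action mu a) (ha_ergodic : ergodic mu a)
    (homega : log_RN_cocycle mu a omega) (ha_III1 : type_III1 mu a omega)
    (dY : measure_display) (Y : measurableType dY)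
    (eta : {sigma_finite_measure set Y -> \bar R})
    (alpha : R -> Y -> Y) (beta : R -> Y -> R)
    (halpha : nonsingular_flow eta alpha) (halpha_ergodic : ergodic eta alpha)
    (hbeta : flow_log_RN_cocycle eta alpha beta) :
  [/\ nonsingular_action (mu \x eta)%E (skew_action a omega alpha),
      ergodic (mu \x eta)%E (skew_action a omega alpha) &
      forall omega' : G -> X * Y -> R,
        log_RN_cocycle (mu \x eta)%E (skew_action a omega alpha) omega' ->
      forall (dZ : measure_display) (Z : measurableType dZ)
        (zeta : {sigma_finite_measure set Z -> \bar R}) (phi : R -> Z -> Z),
        associated_flow (mu \x eta)%E (skew_action a omega alpha) omega'
          zeta phi ->
        adjoint_flow eta alpha zeta phi].
Proof.
have merg := maharam_ergodic_of_III1 ha_III1.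
split.
- exact: (skew_action_nonsingular ha homega halpha).
- have [_ alpha0 alphaD malpha alpha_null] := halpha.
  move=> A /(skew_invariant_set hG merg alpha0 alphaD malpha alpha_null).
  move=> [D /halpha_ergodic[aeD|aeD] AD]; [left|right];
    by apply: filterS2 AD (ae_snd mu aeD) => z ->.
- move=> omega' homega' dZ Z zeta phi.
  exact: (skew_associated_flow_adjoint hG ha homega merg halpha halpha_ergodic
    hbeta homega').
Qed.
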